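(* Let $G$ be a compact Hausdorff abelian group with Haar probability measure $\mu$ and inner Haar measure $\mu_*$. Let $A$ be any subset of $G$, let $B$ be a $K$-analytic subset of $G$, let $\alpha$ be a real number, and suppose that $0<\mu_*(A+B)\leq\alpha\,\mu_*(A)$. Then for all non-negative integers $m,n$ we have $\mu(mB-nB)\leq\alpha^{m+n}\mu_*(A)$.
   Context: The inner Haar measure of $S\subset G$ is $\mu_*(S)=\sup\{\mu(K):K\subset S,\ K\text{ compact}\}$. A subset $S$ of a topological space $Y$ is a $K_{\sigma\delta}$ set if $S=\bigcap_{i\in\mathbb{N}}\bigcup_{j\in\mathbb{N}}K_{i,j}$ for compact $K_{i,j}\subset Y$. A subset $B$ of a Hausdorff space $X$ is $K$-analytic if there is a $K_{\sigma\delta}$ set $S$ in some Hausdorff space and a continuous map $f:S\to X$ with $B=f(S)$. $mB-nB=\{b_1+\dots+b_m-b_1'-\dots-b_n':b_i,b_j'\in B\}$, with an empty sum equal to $0$. *)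

(* Defs.v *)
From HB Require Import structures.
From mathcomp Require Import all_boot all_order all_algebra.
From mathcomp Require Import all_classical all_reals all_analysis.
Set Implicit Arguments. Unset Strict Implicit. Unset Printing Implicit Defensive.
Import Order.TTheory GRing.Theory Num.Theory numFieldNormedType.Exports.
Local Open Scope classical_set_scope.
Local Open Scope ring_scope.

Definition borel_set (T : topologicalType) : set (set T) :=
  smallest (sigma_algebra setT) [set U | open U].

(* A regular Borel probability measure, given as a real-valued set function
   whose values are only meaningful on Borel sets. *)
Definition regular_borel_probability (R : realType) (T : topologicalType)
    (mu : set T -> R) : Prop :=
  [/\ forall E, borel_set E -> 0 <= mu E,
      mu setT = 1,
      (forall F : nat -> set T, (forall n, borel_set (F n)) -> trivIset setT F ->
         (fun n => \sum_(i < n) mu (F i)) @ \oo --> mu (\bigcup_n F n)),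
      (forall E, borel_set E ->
         mu E = sup [set mu K | K in [set K | compact K /\ K `<=` E]]) &
      (forall E, borel_set E ->
         mu E = inf [set mu U | U in [set U | open U /\ E `<=` U]])].

Definition translate (G : zmodType) (x : G) (E : set G) : set G :=
  [set x + y | y in E].

Definition haar_probability (R : realType) (G : topologicalZmodType)
    (mu : set G -> R) : Prop :=
  regular_borel_probability mu /\
  (forall (x : G) E, borel_set E -> mu (translate x E) = mu E).

Definition inner_meas (R : realType) (T : topologicalType)
    (mu : set T -> R) (S : set T) : R :=
  sup [set mu K | K in [set K | compact K /\ K `<=` S]].

Definition outer_meas (R : realType) (T : topologicalType)
    (mu : set T -> R) (S : set T) : R :=
  inf [set mu E | E in [set E | borel_set E /\ S `<=` E]].

Definition sumset (G : zmodType) (A B : set G) : set G :=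
  [set a + b | a in A & b in B].

Fixpoint nsumset (G : zmodType) (n : nat) (B : set G) : set G :=
  match n with
  | O => [set 0]
  | S k => sumset B (nsumset k B)
  end.

Definition diffsumset (G : zmodType) (m n : nat) (B : set G) : set G :=
  [set x - y | x in nsumset m B & y in nsumset n B].

Definition K_sigma_delta (Y : topologicalType) (S : set Y) : Prop :=
  exists K : nat -> nat -> set Y,
    (forall i j, compact (K i j)) /\ S = \bigcap_i \bigcup_j K i j.

Definition K_analytic (X : topologicalType) (B : set X) : Prop :=
  exists (Y : topologicalType) (S : set Y) (f : Y -> X),
    [/\ hausdorff_space Y, K_sigma_delta S, {within S, continuous f} &
        B = f @` S].

(* Main.v *)
Require Import Defs.
From HB Require Import structures.
From mathcomp Require Import all_boot all_order all_algebra.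
From mathcomp Require Import all_classical all_reals all_analysis.
From mathcomp Require Import lra.
Import Order.TTheory GRing.Theory Num.Theory.
Import numFieldNormedType.Exports.
Local Open Scope classical_set_scope.
Local Open Scope ring_scope.

Set Implicit Arguments.
Unset Strict Implicit.

(* Since [mu] is regular and [B] is K-analytic, Choquet's capacitability argument
   reduces the claim to compact [K] and [C] with mu (K + C) < lam * mu K, where
   lam > alpha.  The functional phi X = mu (X + C) - lam * mu X is submodular and
   translation invariant, and phi K < 0.  Submodularity makes phi attain its minimum
   over the sigma-compact subsets of [K], at some [X] with mu X > 0, and then forces
   phi (X + F) <= phi X <= 0 for every finite [F]: since (X + F) `&` (z + X) is the
   translate by z of a subset of [X], adding one point z to [F] does not increase
   phi (X + F).  This is Petridis' proof of Pluennecke's inequality, and gives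
   mu (X + jF) <= lam ^ j * mu X for finite subsets [F] of [C].  Ruzsa's triangle
   inequality, in the form of a double count of (X + mF) `&` (d + X + nF) over [d],
   then bounds mu (mC - nC). *)

(** * Borel probabilities *)

Section BorelSets.
Context {T : topologicalType}.
Implicit Types E F : set T.

Lemma open_borel E : open E -> borel_set E.
Proof. by move=> oE; exact: sub_gen_smallest. Qed.

Lemma borel0 : borel_set (set0 : set T).
Proof. exact: (@sigma_algebra0 _ setT). Qed.

Lemma borelC E : borel_set E -> borel_set (~` E).
Proof. by rewrite -setTD; exact: (@sigma_algebraCD _ setT). Qed.

Lemma borelT : borel_set [set: T].
Proof. by apply: open_borel; exact: openT. Qed.

Lemma borel_bigcup (F : nat -> set T) :
  (forall n, borel_set (F n)) -> borel_set (\bigcup_n F n).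
Proof. exact: (@sigma_algebra_bigcup _ setT). Qed.

Lemma borel_bigcap (F : nat -> set T) :
  (forall n, borel_set (F n)) -> borel_set (\bigcap_n F n).
Proof.
move=> bF; rewrite -(setCK (\bigcap_n F n)) setC_bigcap.
by apply: borelC; apply: borel_bigcup => n; exact: borelC.
Qed.

Lemma borelU E F : borel_set E -> borel_set F -> borel_set (E `|` F).
Proof.
move=> bE bF; rewrite -bigcup2E; apply: borel_bigcup => -[|[|n]] //=.
exact: borel0.
Qed.

Lemma borelI E F : borel_set E -> borel_set F -> borel_set (E `&` F).
Proof.
move=> bE bF; rewrite -(setCK (E `&` F)) setCI.
by apply: borelC; apply: borelU; exact: borelC.
Qed.

Lemma borelD E F : borel_set E -> borel_set F -> borel_set (E `\` F).
Proof. by move=> bE bF; apply: borelI => //; exact: borelC. Qed.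

Lemma compact_borel E : hausdorff_space T -> compact E -> borel_set E.
Proof.
move=> hT cE; rewrite -(setCK E).
by apply: borelC; apply: open_borel; apply: closed_openC; exact: compact_closed.
Qed.

End BorelSets.

Lemma subset_nondecreasing {T : Type} (F : nat -> set T) :
  (forall n, F n `<=` F n.+1) -> {homo F : i j / (i <= j)%N >-> i `<=` j}.
Proof.
move=> ndF i j /subnKC <-; elim: (j - i)%N => [|k IHk]; first by rewrite addn0.
by rewrite addnS => x /IHk; exact: ndF.
Qed.

Lemma cvg_cst_eq {R : realType} (a b : R) : (fun=> a) @ \oo --> b -> a = b.
Proof. by move=> ab; apply: norm_cvg_unique ab; exact: cvg_cst. Qed.

Section BorelProbability.
Context {R : realType} {T : topologicalType} {mu : set T -> R}.
Hypothesis mu_reg : regular_borel_probability mu.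
Implicit Types E F S : set T.

Lemma mu_ge0 E : borel_set E -> 0 <= mu E.
Proof. by case: mu_reg => mu0 _ _ _ _; exact: mu0. Qed.

Lemma mu_setT : mu setT = 1.
Proof. by case: mu_reg. Qed.

(** On the constant empty sequence, consecutive partial sums differ by [mu set0], while convergence
    forces these differences to tend to 0. *)
Lemma mu_set0 : mu set0 = 0.
Proof.
case: mu_reg => _ _ /(_ (fun=> set0) (fun=> borel0)) muU _ _.
have /muU : trivIset setT (fun _ : nat => set0 : set T).
  by apply/trivIsetP => i j _ _ _; rewrite setI0.
rewrite bigcup0 // => cv.
have cvS := cv; rewrite -cvg_shiftS /= in cvS.
have cvB : (\sum_(i < n.+1) mu set0 - \sum_(i < n) mu set0) @[n --> \oo]
    --> mu set0 - mu set0 by exact: cvgB cvS cv.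
apply: cvg_cst_eq; rewrite -[X in _ --> X](subrr (mu set0)).
apply: cvg_trans cvB; apply: near_eq_cvg; apply: nearW => n.
by rewrite big_ord_recr /= addrAC subrr add0r.
Qed.

Lemma muU E F : borel_set E -> borel_set F -> E `&` F = set0 ->
  mu (E `|` F) = mu E + mu F.
Proof.
move=> bE bF EF0; case: mu_reg => _ _ /(_ (bigcup2 E F)) + _ _.
have bEF n : borel_set (bigcup2 E F n).
  by case: n => [|[|n]] //=; exact: borel0.
have triv : trivIset setT (bigcup2 E F).
  apply/trivIsetP => -[|[|i]] [|[|j]] _ _ //= _; rewrite ?setI0 ?set0I //.
  by rewrite setIC.
move=> /(_ bEF triv); rewrite bigcup2E => cvS.
apply/esym/cvg_cst_eq; apply: cvg_trans cvS; apply: near_eq_cvg.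
exists 2%N => // -[|[|n]] //= _.
rewrite !big_ord_recl /= big1 ?addr0 // => i _; exact: mu_set0.
Qed.

Lemma muD E F : borel_set E -> borel_set F -> mu E = mu (E `&` F) + mu (E `\` F).
Proof.
move=> bE bF; rewrite -muU ?setUIDK //; first exact: borelI.
  exact: borelD.
by rewrite setDE setIACA setICr setI0.
Qed.

Lemma mu_le E F : borel_set E -> borel_set F -> E `<=` F -> mu E <= mu F.
Proof.
move=> bE bF EF; rewrite (muD bF bE) (setIidr EF) lerDl.
by apply: mu_ge0; exact: borelD.
Qed.

Lemma mu_le1 E : borel_set E -> mu E <= 1.
Proof. by move=> bE; rewrite -mu_setT; apply: mu_le => //; exact: borelT. Qed.

Lemma mu_modular E F : borel_set E -> borel_set F ->
  mu (E `|` F) + mu (E `&` F) = mu E + mu F.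
Proof.
move=> bE bF; have bU := borelU bE bF.
rewrite (muD bU bE) (muD bF bE) setUK setDUl setDv set0U (setIC F E).
by rewrite -addrA (addrC (mu (F `\` E))).
Qed.

Lemma mu_leU E F : borel_set E -> borel_set F -> mu (E `|` F) <= mu E + mu F.
Proof.
by move=> bE bF; rewrite -mu_modular // lerDl; apply: mu_ge0; exact: borelI.
Qed.

Lemma mu_nondecreasing_cvg (F : nat -> set T) : (forall n, borel_set (F n)) ->
  (forall n, F n `<=` F n.+1) -> mu (F n) @[n --> \oo] --> mu (\bigcup_n F n).
Proof.
move=> bF ndF; have hF : nondecreasing_seq F.
  by move=> m n mn; apply/subsetPset; exact: subset_nondecreasing.
have bD n : borel_set (seqD F n) by case: n => //= n; exact: borelD.
case: mu_reg => _ _ /(_ (seqD F) bD (trivIset_seqD hF)) + _ _.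
rewrite eq_bigcup_seqD -cvg_shiftS.
suff -> : (fun n => \sum_(i < n.+1) mu (seqD F i)) = mu \o F by [].
apply/funext; elim=> [|n IHn]; first by rewrite big_ord_recr big_ord0 /= add0r.
rewrite big_ord_recr /= IHn /= (muD (bF n.+1) (bF n)); congr (mu _ + _).
by rewrite (setIidr (ndF n)).
Qed.

Lemma muC E : borel_set E -> mu (~` E) = 1 - mu E.
Proof.
move=> bE; rewrite -mu_setT (muD borelT bE) setTI setTD.
by rewrite addrAC subrr add0r.
Qed.

Lemma mu_nonincreasing_cvg (F : nat -> set T) : (forall n, borel_set (F n)) ->
  (forall n, F n.+1 `<=` F n) -> mu (F n) @[n --> \oo] --> mu (\bigcap_n F n).
Proof.
move=> bF niF; rewrite -(setCK (\bigcap_n F n)) setC_bigcap.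
have bFC n : borel_set (~` F n) by exact: borelC.
rewrite muC; last exact: borel_bigcup.
have cv : mu (~` F n) @[n --> \oo] --> mu (\bigcup_n ~` F n).
  by apply: (@mu_nondecreasing_cvg (fun n => ~` F n)) => // n; exact: subsetC.
suff -> : (fun n => mu (F n)) = (fun n => 1 - mu (~` F n)).
  by apply: cvgB => //; exact: cvg_cst.
by apply/funext => n; rewrite muC // opprB addrC subrK.
Qed.

Lemma lt_mu_bigcup (F : nat -> set T) t : (forall n, borel_set (F n)) ->
  (forall n, F n `<=` F n.+1) -> t < mu (\bigcup_n F n) ->
  exists n, t < mu (F n).
Proof.
move=> bF ndF tF; have cv := mu_nondecreasing_cvg bF ndF.
apply: contrapT => /forallNP nF; suff : mu (\bigcup_n F n) <= t.
  by rewrite leNgt tF.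
rewrite -(cvg_lim (@norm_hausdorff _ _) cv); apply: limr_le.
  by apply/cvg_ex; eexists; exact: cv.
by apply: nearW => n; rewrite leNgt; apply/negP/nF.
Qed.

Lemma mu_lt_open E t : borel_set E -> mu E < t ->
  exists U, [/\ open U, E `<=` U & mu U < t].
Proof.
move=> bE; case: mu_reg => _ _ _ _ /(_ _ bE) -> /inf_lt -[].
  by exists (mu setT), setT; split => //; exact: openT.
by move=> _ [U [oU EU] <-] Ut; exists U.
Qed.

Lemma outer_meas_le S E : borel_set E -> S `<=` E -> outer_meas mu S <= mu E.
Proof.
move=> bE SE; apply: ge_inf; last by exists E.
by exists 0 => _ [F [bF _] <-]; exact: mu_ge0.
Qed.

Lemma outer_meas_lt S t : outer_meas mu S < t ->
  exists E, [/\ borel_set E, S `<=` E & mu E < t].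
Proof.
move=> /inf_lt [].
  by exists (mu setT), setT; split => //; exact: borelT.
by move=> _ [E [bE SE] <-] Et; exists E.
Qed.

(** The sets [F n] need not be Borel. Near-optimal Borel covers [E n] need not increase, so their
    tail intersections [E'] are used: these are Borel, increase, and still contain the [F n]. *)
Lemma lt_outer_meas_bigcup (F : nat -> set T) t :
  (forall n, F n `<=` F n.+1) -> t < outer_meas mu (\bigcup_n F n) ->
  exists n, t < outer_meas mu (F n).
Proof.
move=> ndF tF; apply: contrapT => /forallNP nF.
pose s := outer_meas mu (\bigcup_n F n).
have /choice[E hE] n : exists E,
    [/\ borel_set E, F n `<=` E & mu E < (t + s) / 2].
  apply: outer_meas_lt; apply: (@le_lt_trans _ _ t); last by rewrite midf_lt.
  by rewrite leNgt; exact/negP/nF.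
pose E' n := \bigcap_k E (n + k)%N.
have bE' n : borel_set (E' n).
  by apply: borel_bigcap => k; have [] := hE (n + k)%N.
have ndE' n : E' n `<=` E' n.+1.
  by move=> x E'x k _; rewrite addSnnS; exact: E'x.
have FE' : \bigcup_n F n `<=` \bigcup_n E' n.
  apply: subset_bigcup => n _ x Fx k _; have [_ + _] := hE (n + k)%N; apply.
  by apply: (subset_nondecreasing ndF) Fx; exact: leq_addr.
have := outer_meas_le (borel_bigcup bE') FE'; rewrite leNgt => /negP; apply.
rewrite ltNge; apply/negP => sE'.
have [n] : exists n, (t + s) / 2 < mu (E' n).
  apply: lt_mu_bigcup => //; by apply: lt_le_trans sE'; rewrite midf_lt.
have [bE _ Et] := hE n; apply/negP; rewrite -leNgt.
apply: le_trans (ltW Et); apply: mu_le => // x /(_ 0%N I).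
by rewrite addn0.
Qed.

Hypothesis hT : hausdorff_space T.

Lemma inner_meas_ge S K : compact K -> K `<=` S -> mu K <= inner_meas mu S.
Proof.
move=> cK KS; apply: ub_le_sup; last by exists K.
by exists 1 => _ [L [cL _] <-]; apply: mu_le1; exact: compact_borel.
Qed.

Lemma inner_meas_gt S t : t < inner_meas mu S ->
  exists K, [/\ compact K, K `<=` S & t < mu K].
Proof.
move=> /sup_gt -[].
  by exists (mu set0), set0; split => //; exact: compact0.
by move=> _ [K [cK KS] <-] tK; exists K.
Qed.

Lemma inner_meas_ge0 S : 0 <= inner_meas mu S.
Proof. by rewrite -mu_set0; apply: inner_meas_ge => //; exact: compact0. Qed.

End BorelProbability.

(** * Sumsets and compactness *)

Section Translates.
Context {G : zmodType}.
Implicit Types (x y : G) (E A B C : set G).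

Lemma translateE x E : translate x E = [set y | E (y - x)].
Proof.
apply/seteqP; split=> [_ [y Ey <-]|y Ey] /=; first by rewrite addrC addKr.
by exists (y - x) => //; rewrite addrC subrK.
Qed.

Lemma translateI x A B :
  translate x (A `&` B) = translate x A `&` translate x B.
Proof. by rewrite !translateE. Qed.

Lemma translateK x : cancel (translate x) (translate (- x)).
Proof.
move=> E; rewrite !translateE /=.
by apply/seteqP; split=> y /=; rewrite opprK addrK.
Qed.

Lemma translateNK x : cancel (translate (- x)) (translate x).
Proof. by move=> E; rewrite -{1}(opprK x) translateK. Qed.

Lemma translateS x A B : A `<=` B -> translate x A `<=` translate x B.
Proof. exact: image_subset. Qed.

Lemma translate_sumset x E : translate x E = sumset [set x] E.
Proof.
apply/seteqP; split=> [_ [y Ey <-]|_ [_ -> [y Ey <-]]]; last by exists y.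
by exists x => //; exists y.
Qed.

Lemma sumsetS A A' B B' : A `<=` A' -> B `<=` B' -> sumset A B `<=` sumset A' B'.
Proof. by move=> AA' BB' _ [a /AA' Aa [b /BB' Bb <-]]; exists a => //; exists b. Qed.

Lemma sumsetC A B : sumset A B = sumset B A.
Proof.
by apply/seteqP; split=> _ [a Aa [b Bb <-]]; rewrite addrC; exists b => //; exists a.
Qed.

Lemma sumsetA A B C : sumset A (sumset B C) = sumset (sumset A B) C.
Proof.
apply/seteqP; split.
  move=> _ [a Aa [_ [b Bb [c Cc <-]] <-]]; exists (a + b).
    by exists a => //; exists b.
  by exists c => //; rewrite addrA.
move=> _ [_ [a Aa [b Bb <-]] [c Cc <-]]; exists a => //; exists (b + c).
  by exists b => //; exists c.
by rewrite addrA.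
Qed.

Lemma sumset0r A : sumset A [set 0] = A.
Proof.
apply/seteqP; split=> [_ [a Aa [_ -> <-]]|a Aa]; first by rewrite addr0.
by exists a => //; exists 0; rewrite ?addr0.
Qed.

Lemma sumsetUl A B C : sumset (A `|` B) C = sumset A C `|` sumset B C.
Proof.
apply/seteqP; split.
  by move=> _ [a [Aa|Ba] [c Cc <-]]; [left|right]; exists a => //; exists c.
move=> _ [[a Aa [c Cc <-]]|[a Aa [c Cc <-]]];
  by exists a; [(left + right)|exists c].
Qed.

Lemma sumsetUr A B C : sumset C (A `|` B) = sumset C A `|` sumset C B.
Proof. by rewrite !(sumsetC C) sumsetUl. Qed.

Lemma translate_sumsetl x A B : translate x (sumset A B) = sumset (translate x A) B.
Proof. by rewrite !translate_sumset sumsetA. Qed.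

Lemma sumset_nondecreasing_bigcup (F H : nat -> set G) :
  (forall n, F n `<=` F n.+1) -> (forall n, H n `<=` H n.+1) ->
  sumset (\bigcup_n F n) (\bigcup_n H n) = \bigcup_n sumset (F n) (H n).
Proof.
move=> ndF ndH; apply/seteqP; split.
  move=> _ [a [i _ Fa] [b [j _ Hb] <-]]; exists (maxn i j) => //.
  exists a; first exact: (subset_nondecreasing ndF (leq_maxl i j)).
  by exists b => //; exact: (subset_nondecreasing ndH (leq_maxr i j)).
by move=> _ [n _ [a Fa [b Hb <-]]]; exists a; [exists n|exists b => //; exists n].
Qed.

Lemma nsumsetS n A B : A `<=` B -> nsumset n A `<=` nsumset n B.
Proof. by move=> AB; elim: n => [//|n IHn]; exact: sumsetS. Qed.

Lemma diffsumsetS m n A B : A `<=` B -> diffsumset m n A `<=` diffsumset m n B.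
Proof.
move=> AB _ [x mx [y ny <-]]; exists x; first exact: nsumsetS mx.
by exists y => //; exact: nsumsetS ny.
Qed.

Lemma nsumset_sumset n A B :
  nsumset n (sumset A B) = sumset (nsumset n A) (nsumset n B).
Proof.
elim: n => [|n IHn] /=; first by rewrite sumset0r.
rewrite IHn -!sumsetA; congr sumset.
by rewrite !sumsetA (sumsetC B).
Qed.

Lemma diffsumset_sumset m n A B :
  diffsumset m n (sumset A B) `<=` sumset (diffsumset m n A) (diffsumset m n B).
Proof.
move=> _ [x mx [y ny <-]]; move: mx ny; rewrite !nsumset_sumset.
move=> [a ma [b mb <-]] [a' na [b' nb <-]].
exists (a - a'); first by exists a => //; exists a'.
exists (b - b'); first by exists b => //; exists b'.
by rewrite opprD addrACA.
Qed.

Lemma nsumset_nondecreasing_bigcup n (F : nat -> set G) :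
  (forall n, F n `<=` F n.+1) ->
  nsumset n (\bigcup_k F k) = \bigcup_k nsumset n (F k).
Proof.
move=> ndF; elim: n => [|n IHn] /=; first by rewrite bigcup_const//; exists 0%N.
rewrite IHn sumset_nondecreasing_bigcup // => k; exact: nsumsetS.
Qed.

Lemma diffsumset_nondecreasing_bigcup m n (F : nat -> set G) :
  (forall n, F n `<=` F n.+1) ->
  diffsumset m n (\bigcup_k F k) = \bigcup_k diffsumset m n (F k).
Proof.
move=> ndF; apply/seteqP; split; last first.
  by move=> x [k _]; apply: diffsumsetS => y Fy; exists k.
move=> _ [a ma [b nb <-]]; move: ma nb; rewrite !nsumset_nondecreasing_bigcup //.
move=> [i _ Fa] [j _ Fb]; exists (maxn i j) => //.
exists a; first by apply: nsumsetS Fa; exact: subset_nondecreasing (leq_maxl _ _).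
by exists b => //; apply: nsumsetS Fb; exact: subset_nondecreasing (leq_maxr _ _).
Qed.

End Translates.

(** A sum of Borel sets need not be Borel. In a Hausdorff group the sets of this class are Borel,
    and the class is stable under sums, translates and intersections; an increasing sequence lets
    these be formed term by term. *)
Definition sigma_compact {T : topologicalType} (S : set T) : Prop :=
  exists F : nat -> set T,
    [/\ forall n, compact (F n), forall n, F n `<=` F n.+1 & S = \bigcup_n F n].

Section Compactness.
Context {T : topologicalType}.
Implicit Types (K S : set T).

Lemma compact_nondecreasing_cover K (V : nat -> set T) : compact K ->
  (forall n, open (V n)) -> (forall n, V n `<=` V n.+1) ->
  K `<=` \bigcup_n V n -> exists n, K `<=` V n.
Proof.
move=> /compact_near_coveringP cK oV ndV KV.
have [x Kx|n _ hn] := cK nat \oo (fun n x => V n x) _; last first.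
  by exists n; exact: (hn n (leqnn n)).
have [n _ Vx] := KV x Kx; exists (V n, [set k | (n <= k)%N]).
  by split; [apply: open_nbhs_nbhs; split => /=|exists n].
by move=> [y k] [/= Vy nk]; exact: (subset_nondecreasing ndV nk).
Qed.

Lemma compact_finite_cover K (I : eqType) (V : I -> set T) : compact K ->
  (forall i, open (V i)) -> K `<=` \bigcup_i V i ->
  exists s : seq I, K `<=` [set x | exists2 i, i \in s & V i x].
Proof.
move=> /compact_near_coveringP cK oV KV.
(* Finite lists are directed by inclusion; near-covering along this filter yields one list that
   serves all of [K]. *)
pose F := filter_from [set: seq I] (fun s => [set t : seq I | {subset s <= t}]).
have FF : Filter F.
  apply: filter_from_filter; first by exists [::].
  move=> s t _ _; exists (s ++ t) => // u su; split=> i i_s; apply: su;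
  by rewrite mem_cat i_s ?orbT.
have [x Kx|s _ hs] := cK _ F (fun s x => exists2 i, i \in s & V i x) FF; last first.
  by exists s; apply: hs => /=.
have [i _ Vx] := KV x Kx; exists (V i, [set t : seq I | {subset [:: i] <= t}]).
  by split; [apply: open_nbhs_nbhs; split => /=|exists [:: i]].
by move=> [y t] [/= Vy it]; exists i => //; apply: it; rewrite mem_head.
Qed.

Lemma compact_sigma_compact K : compact K -> sigma_compact K.
Proof. move=> cK; exists (fun=> K); split=> [//|n x //|].
by rewrite bigcup_const //; exists 0%N. Qed.

Hypothesis hT : hausdorff_space T.

Lemma compactI K K' : compact K -> compact K' -> compact (K `&` K').
Proof. by move=> cK cK'; apply: compact_closedI => //; exact: compact_closed. Qed.

Lemma sigma_compactI S S' :
  sigma_compact S -> sigma_compact S' -> sigma_compact (S `&` S').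
Proof.
move=> [F [cF ndF ->]] [F' [cF' ndF' ->]]; exists (fun n => F n `&` F' n); split.
- by move=> n; exact: compactI.
- by move=> n; exact: setISS.
- apply/seteqP; split=> [x [[i _ Fx] [j _ F'x]]|x [n _ [Fx F'x]]]; last first.
    by split; exists n.
  exists (maxn i j) => //; split.
    exact: (subset_nondecreasing ndF (leq_maxl _ _)).
  exact: (subset_nondecreasing ndF' (leq_maxr _ _)).
Qed.

Lemma sigma_compact_borel S : sigma_compact S -> borel_set S.
Proof.
by move=> [F [cF _ ->]]; apply: borel_bigcup => n; exact: compact_borel.
Qed.

End Compactness.

(** * Compact and open sets in a topological group *)

Section TopologicalGroup.
Context {G : topologicalZmodType}.
Implicit Types (x : G) (A B C K U E : set G).

Lemma compact_sumset A B : compact A -> compact B -> compact (sumset A B).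
Proof.
move=> cA cB; have -> : sumset A B = (fun p : G * G => p.1 + p.2) @` (A `*` B).
  apply/seteqP; split=> [_ [a Aa [b Bb <-]]|_ [[a b] [Aa Bb] <-]].
    by exists (a, b).
  by exists a => //; exists b.
apply: continuous_compact.
  exact/continuous_subspaceT/add_continuous.
exact: compact_setX.
Qed.

Lemma compact_opp A : compact A -> compact (-%R @` A).
Proof.
move=> cA; apply: continuous_compact => //.
exact/continuous_subspaceT/opp_continuous.
Qed.

Lemma compact_translate x A : compact A -> compact (translate x A).
Proof.
move=> cA; rewrite translate_sumset; apply: compact_sumset => //.
exact: compact_set1.
Qed.

Lemma compact_nsumset n A : compact A -> compact (nsumset n A).
Proof.
move=> cA; elim: n => [|n IHn] /=; first exact: compact_set1.
exact: compact_sumset.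
Qed.

Lemma compact_diffsumset m n A : compact A -> compact (diffsumset m n A).
Proof.
move=> cA; have -> : diffsumset m n A =
    (fun p : G * G => p.1 - p.2) @` (nsumset m A `*` nsumset n A).
  apply/seteqP; split=> [_ [a Aa [b Bb <-]]|_ [[a b] [Aa Bb] <-]].
    by exists (a, b).
  by exists a => //; exists b.
apply: continuous_compact.
  exact/continuous_subspaceT/sub_continuous.
by apply: compact_setX; exact: compact_nsumset.
Qed.

Lemma open_translate x U : open U -> open (translate x U).
Proof.
move=> oU; rewrite translateE.
apply: (@open_comp _ _ (fun y => y - x)) => // y _.
apply: (@continuous_comp _ _ _ (fun y => (y, - x)) (fun p : G * G => p.1 + p.2)).
  by apply: cvg_pair => /=; [exact: cvg_id|exact: cvg_cst].
exact: add_continuous.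
Qed.

Lemma open_sumsetr A U : open U -> open (sumset A U).
Proof.
move=> oU; have -> : sumset A U = \bigcup_(a in A) translate a U.
  by apply/seteqP; split=> _ [a Aa [u Uu <-]]; exists a => //; exists u.
by apply: bigcup_open => a _; exact: open_translate.
Qed.

Lemma sigma_compact_sumset A B :
  sigma_compact A -> sigma_compact B -> sigma_compact (sumset A B).
Proof.
move=> [F [cF ndF ->]] [H [cH ndH ->]]; exists (fun n => sumset (F n) (H n)).
split; last exact: sumset_nondecreasing_bigcup.
- by move=> n; exact: compact_sumset.
- by move=> n; exact: sumsetS.
Qed.

Lemma sigma_compact_translate x A : sigma_compact A -> sigma_compact (translate x A).
Proof.
move=> sA; rewrite translate_sumset; apply: sigma_compact_sumset => //.
exact/compact_sigma_compact/compact_set1.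
Qed.

Lemma nbhs0_nsumset n U : nbhs (0 : G) U ->
  exists V, [/\ open V, V 0 & nsumset n V `<=` U].
Proof.
elim: n U => [|n IHn] U U0.
  exists setT; split => //; first exact: openT.
  by move=> _ ->; exact: nbhs_singleton.
have := @add_continuous G (0, 0) U; rewrite /= addr0 => /(_ U0).
move=> [[A B] [/= A0 B0] ABU]; have [V [oV V0 VB]] := IHn B B0.
exists (A° `&` V); split.
- by apply: openI => //; exact: open_interior.
- by split.
- move=> _ [a [/interior_subset Aa _] [b nb <-]]; apply: (ABU (a, b)); split => //.
  by apply: VB; apply: nsumsetS nb => ? [].
Qed.

Lemma nbhs0_diffsumset m n U : nbhs (0 : G) U ->
  exists V, [/\ open V, V 0 & diffsumset m n V `<=` U].
Proof.
move=> U0; have := @sub_continuous G (0, 0) U; rewrite /= subr0 => /(_ U0).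
move=> [[A B] [/= A0 B0] ABU].
have [V [oV V0 VA]] := nbhs0_nsumset m A0.
have [W [oW W0 WB]] := nbhs0_nsumset n B0.
exists (V `&` W); split=> //; first exact: openI.
move=> _ [a ma [b nb <-]]; apply: (ABU (a, b)); split.
  by apply: VA; apply: nsumsetS ma => ? [].
by apply: WB; apply: nsumsetS nb => ? [].
Qed.

(** A tube lemma: continuity of addition gives a neighbourhood of 0 that works near each point of
    [K], and compactness merges these into one. *)
Lemma compact_open_sumset K U : compact K -> open U -> K `<=` U ->
  exists2 V, nbhs (0 : G) V & sumset K V `<=` U.
Proof.
move=> /compact_near_coveringP cK oU KU.
have hK x : K x -> \forall x' \near x & v \near (0 : G), U (x' + v).
  move=> Kx; have := @add_continuous G (x, 0) U; apply.
  by rewrite /= addr0; apply: open_nbhs_nbhs; split => //; exact: KU.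
have hV := cK G (nbhs 0) (fun v x => U (x + v)) _ hK.
exists [set v | K `<=` (fun x => U (x + v))]; first exact: hV.
by move=> _ [x Kx [v hv <-]]; exact: hv.
Qed.

(** The open set is [K + V] for a small neighbourhood [V] of 0, because m(K + V) - n(K + V) lies in
    (mK - nK) + (mV - nV). *)
Lemma compact_open_diffsumset m n K U : compact K -> open U ->
  diffsumset m n K `<=` U ->
  exists V, [/\ open V, K `<=` V & diffsumset m n V `<=` U].
Proof.
move=> cK oU KU; have cD : compact (diffsumset m n K) := compact_diffsumset cK.
have [W W0 WU] := compact_open_sumset cD oU KU.
have [V [oV V0 VW]] := nbhs0_diffsumset m n W0.
exists (sumset K V); split; first exact: open_sumsetr.
  by move=> x Kx; exists x => //; exists 0; rewrite ?addr0.
move=> x /diffsumset_sumset Dx; apply: WU; apply: sumsetS Dx => //.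
Qed.

End TopologicalGroup.

(** * Petridis' minimizer *)

Section PetridisMinimizer.
Context {R : realType} {G : topologicalZmodType} {mu : set G -> R}.
Hypothesis hG : hausdorff_space G.
Hypothesis mu_haar : haar_probability mu.

Let mu_reg : regular_borel_probability mu := mu_haar.1.
Let mu_translate : forall x E, borel_set E -> mu (translate x E) = mu E :=
  mu_haar.2.

Variables (C : set G) (lam : R).
Hypotheses (compactC : compact C) (lam_ge0 : 0 <= lam).

Definition plunnecke_defect (X : set G) : R := mu (sumset X C) - lam * mu X.
Local Notation phi := plunnecke_defect.

Let sigmaC : sigma_compact C := compact_sigma_compact compactC.

Let borel_sigma (X : set G) : sigma_compact X -> borel_set X :=
  @sigma_compact_borel _ hG X.

Let borel_sumC (X : set G) : sigma_compact X -> borel_set (sumset X C).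
Proof. by move=> sX; apply: borel_sigma; exact: sigma_compact_sumset. Qed.

(** Adding [C] commutes with unions but only sends an intersection into the intersection of the two
    sums; modularity of [mu] turns this inclusion into the inequality. *)
Lemma plunnecke_defect_submodular (X Y : set G) :
  sigma_compact X -> sigma_compact Y ->
  phi (X `|` Y) + phi (X `&` Y) <= phi X + phi Y.
Proof.
move=> sX sY; rewrite /phi sumsetUl.
have := mu_modular mu_reg (borel_sigma sX) (borel_sigma sY).
have := mu_modular mu_reg (borel_sumC sX) (borel_sumC sY).
have : mu (sumset (X `&` Y) C) <= mu (sumset X C `&` sumset Y C).
  apply: (mu_le mu_reg).
  - by apply: borel_sumC; exact: sigma_compactI.
  - by apply: borelI; exact: borel_sumC.
  - by move=> x XYx; split; apply: sumsetS XYx => // y [].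
move: (mu (X `|` Y)) (mu (X `&` Y)) => u i le_i eC eXY.
have : lam * u + lam * i = lam * mu X + lam * mu Y by rewrite -!mulrDr eXY.
by lra.
Qed.

Lemma plunnecke_defect_translate x (X : set G) :
  sigma_compact X -> phi (translate x X) = phi X.
Proof.
move=> sX; rewrite /phi -translate_sumsetl !mu_translate //.
  exact: borel_sigma.
exact: borel_sumC.
Qed.

Lemma plunnecke_defect_ge (X : set G) : sigma_compact X -> - lam <= phi X.
Proof.
move=> sX; rewrite /phi.
have := mu_ge0 mu_reg (borel_sumC sX).
have : lam * mu X <= lam * 1.
  by apply: ler_wpM2l => //; exact: (mu_le1 mu_reg (borel_sigma sX)).
by lra.
Qed.

Lemma plunnecke_defect_cvg (F : nat -> set G) :
  (forall n, sigma_compact (F n)) -> (forall n, F n `<=` F n.+1) ->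
  phi (F n) @[n --> \oo] --> phi (\bigcup_n F n).
Proof.
move=> sF ndF; have sumF : sumset (\bigcup_n F n) C = \bigcup_n sumset (F n) C.
  have CE : C = \bigcup_(n : nat) C by rewrite bigcup_const //; exists 0%N.
  by rewrite {1}CE sumset_nondecreasing_bigcup // => n x.
rewrite /phi sumF; apply: cvgB.
  apply: (mu_nondecreasing_cvg mu_reg (F := fun n => sumset (F n) C)).
    by move=> n; exact: borel_sumC.
  by move=> n; exact: sumsetS.
apply: cvgM; first exact: cvg_cst.
apply: (mu_nondecreasing_cvg mu_reg) => // n.
exact: borel_sigma.
Qed.

(* Minimizing sequence [Y]: by submodularity the finite intersections
   [Y N `&` ... `&` Y (N + k)] stay within 2 * 2^-N of the infimum, hence so do
   the compact sets [T N] below, whose increasing union is a minimizer. *)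
Lemma plunnecke_defect_minimizer (K : set G) : compact K ->
  exists X, [/\ sigma_compact X, X `<=` K &
    forall Y, sigma_compact Y -> Y `<=` K -> phi X <= phi Y].
Proof.
move=> cK; pose V := [set phi Y | Y in [set Y | compact Y /\ Y `<=` K]].
have V0 : V !=set0 by exists (phi K), K => //; split.
have I_le Y : compact Y -> Y `<=` K -> inf V <= phi Y.
  move=> cY YK; apply: ge_inf; last by exists Y.
  exists (- lam) => _ [Z [cZ _] <-].
  by apply: plunnecke_defect_ge; exact: compact_sigma_compact.
have I_le_sigma Y : sigma_compact Y -> Y `<=` K -> inf V <= phi Y.
  move=> [F [cF ndF ->]] FK.
  have cv : phi (F n) @[n --> \oo] --> phi (\bigcup_n F n).
    by apply: plunnecke_defect_cvg => // n; exact: compact_sigma_compact.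
  apply: (ler_cvg_to (cvg_cst (inf V)) cv); apply: nearW => n.
  by apply: I_le => // x Fx; apply: FK; exists n.
pose e n : R := 2^-1 ^+ n.
have eS n : e n = 2 * e n.+1 by rewrite /e exprS mulrA divff ?mul1r.
have e_gt0 n : 0 < e n by rewrite exprn_gt0 // invr_gt0.
have /choice[Y hY] n : exists Y, [/\ compact Y, Y `<=` K & phi Y < inf V + e n].
  have [] := @inf_lt _ V (inf V + e n) V0; first by rewrite ltrDl.
  by move=> _ [Y [cY YK] <-] Ye; exists Y.
pose t N := fix t k := if k is k'.+1 then t k' `&` Y (N + k)%N else Y N.
have t_comp N k : compact (t N k).
  elim: k => [|k IHk] /=; first by case: (hY N).
  by apply: compactI => //; case: (hY (N + k.+1)%N).
have tK N k : t N k `<=` K.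
  by elim: k => [|k IHk] /=; [case: (hY N)|move=> x [/IHk]].
(* The union has defect at least [inf V], so submodularity adds at most the error [e (N + k.+1)] at
   each step. As [e (N + k)] is twice that, the subtracted term absorbs it. *)
have t_phi N k : phi (t N k) <= inf V + 2 * e N - e (N + k)%N.
  elim: k => [|k IHk]; first by rewrite addn0 /=; case: (hY N); lra.
  have [cY YK Ye] := hY (N + k.+1)%N.
  have := plunnecke_defect_submodular (compact_sigma_compact (t_comp N k))
    (compact_sigma_compact cY).
  have cU := compactU (t_comp N k) cY.
  have UK : t N k `|` Y (N + k.+1)%N `<=` K by move=> x [/tK|/YK].
  have := I_le _ cU UK; move: IHk Ye.
  by rewrite /= addnS (eS (N + k)%N); lra.
pose T N := \bigcap_k t N k.
(* [T N] is the intersection of all [Y j] with [j >= N], hence increases with [N]. *)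
have TE N x : T N x <-> forall k, Y (N + k)%N x.
  split=> [Tx k|Yx k _].
    by have := Tx k I; case: k => [|k] /=; [rewrite addn0|case].
  elim: k => [|k IHk] /=; first by have := Yx 0%N; rewrite addn0.
  by split.
have T_comp N : compact (T N).
  apply: (subclosed_compact _ (t_comp N 0%N)); last by move=> x; apply.
  by apply: closed_bigI => k _; exact: compact_closed.
have T_nd N : T N `<=` T N.+1.
  by move=> x /TE Tx; apply/TE => k; rewrite addSnnS; exact: Tx.
have TK N : T N `<=` K by move=> x /(_ 0%N I) /tK.
(* Only the term in [lam] is passed to the limit in [k]; the sumset term is bounded by monotonicity,
   as [T N] lies in every [t N k]. *)
have T_phi N : phi (T N) <= inf V + 2 * e N.
  rewrite /phi lerBlDr.
  have cv : mu (t N k) @[k --> \oo] --> mu (T N).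
    apply: (mu_nonincreasing_cvg mu_reg) => k; last by move=> x [].
    exact: compact_borel.
  have cv' : (inf V + 2 * e N + lam * mu (t N k)) @[k --> \oo]
      --> inf V + 2 * e N + lam * mu (T N).
    by apply: cvgD; [exact: cvg_cst|apply: cvgM => //; exact: cvg_cst].
  apply: (ler_cvg_to (cvg_cst (mu (sumset (T N) C))) cv'); apply: nearW => k.
  apply: (@le_trans _ _ (mu (sumset (t N k) C))).
    apply: (mu_le mu_reg); [| |by apply: sumsetS => // x; apply].
      by apply: borel_sumC; exact: compact_sigma_compact.
    by apply: borel_sumC; exact: compact_sigma_compact.
  by have := t_phi N k; have := e_gt0 (N + k)%N; rewrite /phi; lra.
exists (\bigcup_N T N); split; first by exists T.
  by move=> x [N _ /TK].
move=> Z sZ ZK; apply: le_trans (I_le_sigma Z sZ ZK).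
have cv : phi (T N) @[N --> \oo] --> phi (\bigcup_N T N).
  by apply: plunnecke_defect_cvg => // N; exact: compact_sigma_compact.
have cve : (inf V + 2 * e N) @[N --> \oo] --> inf V + 2 * 0.
  apply: cvgD; first exact: cvg_cst.
  apply: cvgM; first exact: cvg_cst.
  apply: cvg_expr.
  by rewrite ger0_norm ?invr_ge0 // invf_lt1 // ltr1n.
rewrite mulr0 addr0 in cve.
by apply: (ler_cvg_to cv cve); apply: nearW.
Qed.

Lemma plunnecke_defect_sumset (K X : set G) (s : seq G) :
  sigma_compact X -> X `<=` K ->
  (forall Y, sigma_compact Y -> Y `<=` K -> phi X <= phi Y) ->
  phi X <= 0 -> phi (sumset X [set` s]) <= 0.
Proof.
move=> sX XK minX phiX0.
have fin (r : seq G) : sigma_compact [set` r].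
  by apply: compact_sigma_compact; apply: finite_compact; exact: finite_seq.
(* The empty sum has defect 0, possibly above [phi X]. For nonempty lists the stronger bound by
   [phi X] is proved, by induction from a singleton. *)
case: s => [|z s].
  have -> : sumset X [set` [::]] = set0.
    by rewrite -subset0 => y [x _ []].
  have -> : phi set0 = 0; last by [].
  rewrite /phi; have -> : sumset set0 C = set0 by rewrite -subset0 => y [x []].
  by rewrite (mu_set0 mu_reg) mulr0 subr0.
apply: le_trans phiX0; elim: s z => [|z' s IHs] z.
  have -> : sumset X [set` [:: z]] = translate z X.
    rewrite translate_sumset sumsetC; congr sumset.
    by apply/seteqP; split=> y /=; rewrite inE => /eqP.
  by rewrite plunnecke_defect_translate.
set Z := [set` z' :: s]; have sXZ : sigma_compact (sumset X Z).
  by apply: sigma_compact_sumset => //; exact: fin.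
have sz : sigma_compact (translate z X) by exact: sigma_compact_translate.
have -> : sumset X [set` z :: z' :: s] = sumset X Z `|` translate z X.
  rewrite translate_sumset (sumsetC [set z]) -sumsetUr; congr sumset.
  apply/seteqP; split=> y /=.
    by rewrite in_cons => /orP[/eqP ->|]; [right|left].
  by case=> [ys|->]; rewrite in_cons ?eqxx // ys orbT.
have := plunnecke_defect_submodular sXZ sz.
rewrite [phi (translate z X)]plunnecke_defect_translate //.
(* The overlap is the translate by [z] of [W], a subset of [X]. Minimality gives [phi X <= phi W],
   which cancels the contribution [phi X] of the new translate. *)
pose W := translate (- z) (sumset X Z) `&` X.
have -> : sumset X Z `&` translate z X = translate z W.
  by rewrite translateI translateNK.
have sW : sigma_compact W.
  by apply: sigma_compactI => //; exact: sigma_compact_translate.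
rewrite plunnecke_defect_translate //.
have := minX W sW; have /[swap] /[apply] : W `<=` K by move=> x [_ /XK].
have := IHs z'; rewrite -/Z.
by lra.
Qed.

Lemma nsumset_seq n (s : seq G) : exists t : seq G, nsumset n [set` s] = [set` t].
Proof.
elim: n => [|n [t IHn]] /=.
  by exists [:: 0]; apply/seteqP; split=> y /=; rewrite inE => /eqP.
exists [seq a + b | a <- s, b <- t]; rewrite IHn; apply/seteqP; split=> x.
  by move=> [a sa [b tb <-]]; apply/allpairsP; exists (a, b).
by move=> /allpairsP[[a b] /= [sa tb ->]]; exists a => //; exists b.
Qed.

(** One more summand from [s] is bounded by adding all of [C]. The n-fold sum of [s] is again
    finite, so the defect bound applies to it and costs one factor [lam]. *)
Lemma plunnecke_finite (K X : set G) (s : seq G) n :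
  sigma_compact X -> X `<=` K ->
  (forall Y, sigma_compact Y -> Y `<=` K -> phi X <= phi Y) ->
  phi X <= 0 -> [set` s] `<=` C ->
  mu (sumset X (nsumset n [set` s])) <= lam ^+ n * mu X.
Proof.
move=> sX XK minX phiX0 sC; elim: n => [|n IHn] /=.
  by rewrite sumset0r mul1r.
have [t nE] := nsumset_seq n s.
have st : sigma_compact [set` t].
  by apply: compact_sigma_compact; apply: finite_compact; exact: finite_seq.
have ss : sigma_compact [set` s].
  by apply: compact_sigma_compact; apply: finite_compact; exact: finite_seq.
have sXn : sigma_compact (sumset X (nsumset n [set` s])).
  by rewrite nE; exact: sigma_compact_sumset.
rewrite (sumsetC [set` s]) sumsetA exprS -mulrA.
apply: (@le_trans _ _ (lam * mu (sumset X (nsumset n [set` s])))).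
  apply: (@le_trans _ _ (mu (sumset (sumset X (nsumset n [set` s])) C))).
    apply: (mu_le mu_reg); last exact: sumsetS.
      by apply: borel_sigma; exact: sigma_compact_sumset.
    exact: borel_sumC.
  have := plunnecke_defect_sumset t sX XK minX phiX0.
  by rewrite -nE /phi subr_le0.
exact: ler_wpM2l.
Qed.

End PetridisMinimizer.

(** * Finite double counting *)

Section FiniteSums.
Context {R : realType} {T : topologicalType} {mu : set T -> R}.
Hypothesis mu_reg : regular_borel_probability mu.

Lemma mu_le_sum (E : nat -> set T) n D : (forall i, borel_set (E i)) ->
  borel_set D -> (forall x, D x -> exists2 i, (i < n)%N & E i x) ->
  mu D <= \sum_(i < n) mu (E i).
Proof.
move=> bE; elim: n D => [|n IHn] D bD DE.
  have -> : D = set0 by rewrite -subset0 => x /DE[].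
  by rewrite big_ord0 (mu_set0 mu_reg).
rewrite big_ord_recr /= (muD mu_reg bD (bE n)) [X in X <= _]addrC; apply: lerD.
  apply: IHn; first exact: borelD.
  move=> x [Dx nEx]; have [i] := DE x Dx; rewrite ltnS leq_eqVlt.
  by move=> /orP[/eqP -> //|lt_in Ex]; exists i.
by apply: (mu_le mu_reg); [exact: borelI| |move=> x []].
Qed.

Lemma sum_mu_le (E : nat -> set T) n O : (forall i, borel_set (E i)) ->
  trivIset setT E -> borel_set O -> (forall i, (i < n)%N -> E i `<=` O) ->
  \sum_(i < n) mu (E i) <= mu O.
Proof.
move=> bE tE; elim: n O => [|n IHn] O bO EO.
  by rewrite big_ord0; exact: (mu_ge0 mu_reg).
rewrite big_ord_recr /= (muD mu_reg bO (bE n)) [X in _ <= X]addrC.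
rewrite (setIidr (EO n _)) // lerD2r; apply: IHn; first exact: borelD.
move=> i lt_in x Ex; split; first exact: (EO i (ltnW lt_in)).
move=> Enx; have := lt_in; rewrite (_ : i = n) ?ltnn //.
by apply: tE => //; exists x.
Qed.

(** This stands for integrating the pointwise bound over [P]. Induction splits [P] along [E n];
    inside [E n] the weight [a n] is moved into the bound [s]. *)
Lemma weighted_sum_mu_le (a : nat -> R) (E : nat -> set T) n P s :
  (forall i, borel_set (E i)) -> borel_set P ->
  (forall x, P x -> \sum_(i < n) a i * \1_(E i) x <= s) ->
  \sum_(i < n) a i * mu (P `&` E i) <= s * mu P.
Proof.
move=> bE; elim: n P s => [|n IHn] P s bP sP.
  (* With no terms the pointwise bound says [0 <= s], but only when [P] has a point. *)
  rewrite big_ord0; have [->|/set0P[x Px]] := eqVneq P set0.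
    by rewrite (mu_set0 mu_reg) mulr0 lexx.
  have := sP x Px; rewrite big_ord0 => s0.
  by apply: mulr_ge0 => //; exact: (mu_ge0 mu_reg).
rewrite big_ord_recr /=.
have -> : \sum_(i < n) a i * mu (P `&` E i) =
    \sum_(i < n) a i * mu ((P `&` E n) `&` E i) +
    \sum_(i < n) a i * mu ((P `\` E n) `&` E i).
  rewrite -big_split; apply: eq_bigr => i _ /=; rewrite -mulrDr; congr (_ * _).
  rewrite (muD mu_reg (borelI bP (bE i)) (bE n)); congr (mu _ + mu _).
    by rewrite setIAC.
  by rewrite !setDE setIAC.
have le1 : \sum_(i < n) a i * mu ((P `&` E n) `&` E i) <=
    (s - a n) * mu (P `&` E n).
  apply: IHn; first exact: borelI.
  move=> x [Px Enx]; have := sP x Px.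
  by rewrite big_ord_recr /= indicE mem_set // mulr1 lerBrDr.
have le2 : \sum_(i < n) a i * mu ((P `\` E n) `&` E i) <= s * mu (P `\` E n).
  apply: IHn; first exact: borelD.
  move=> x [Px nEnx]; have := sP x Px.
  by rewrite big_ord_recr /= indicE memNset // mulr0 addr0.
rewrite [mu P](muD mu_reg bP (bE n)) mulrDr.
by move: le1 le2; rewrite mulrBl; lra.
Qed.

End FiniteSums.

(** * Ruzsa's inequality and capacitability *)

Section CompactGroup.
Context {R : realType} {G : topologicalZmodType} {mu : set G -> R}.
Hypothesis hG : hausdorff_space G.
Hypothesis compactG : compact [set: G].
Hypothesis mu_haar : haar_probability mu.

Let mu_reg : regular_borel_probability mu := mu_haar.1.
Let mu_translate : forall x E, borel_set E -> mu (translate x E) = mu E :=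
  mu_haar.2.

(** Double count of the pairs (x, d) with [d] in [D] and [x] in both [P] and [d + Q]: for fixed [x],
    such [d] lie in [x - Q]. The count is discretized by cutting [D] into finitely many small Borel
    pieces. *)
Let mu_mul_le_opp (c : R) P Q D : 0 <= c ->
  borel_set P -> compact Q -> borel_set D ->
  (forall d, D d -> c <= mu (P `&` translate d Q)) ->
  c * mu D <= mu P * mu (-%R @` Q).
Proof.
move=> c0 bP cQ bD cD; have cNQ := compact_opp cQ.
have bNQ := compact_borel hG cNQ.
apply/ler_addgt0Pr => eps eps0.
have [U [oU NQU Ueps]] : exists U, [/\ open U, -%R @` Q `<=` U &
    mu U < mu (-%R @` Q) + eps].
  by apply: (mu_lt_open mu_reg) => //; rewrite ltrDl.
(* [V] will be so small that [-Q + (V - V)] stays in [U], whose measure is close to that of [-Q]. *)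
have [W W0 WU] := compact_open_sumset cNQ oU NQU.
have [V [oV V0 VW]] := nbhs0_diffsumset 1 1 W0.
have [s sG] := @compact_finite_cover _ _ _ (fun v => translate v V) compactG
  (fun v => open_translate v oV)
  (fun x _ => ex_intro2 _ _ x I (ex_intro2 _ _ 0 V0 (addr0 x))).
(* The default 0 is harmless, since all sums stop before [size s]. The [E i] are disjoint pieces of
   [D] with [E i] inside [v i + V], and [T i] contains [d + Q] for every [d] in [E i]. *)
pose v i := nth 0 s i.
pose E i := D `&` seqDU (fun i => translate (v i) V) i.
pose T i := translate (v i) (sumset Q V).
have bV i : borel_set (translate (v i) V).
  by apply: open_borel; exact: open_translate.
have borE i : borel_set (E i).
  apply: borelI => //; apply: borelD => //; elim: i => [|i IHi].
    by rewrite big_ord0; exact: borel0.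
  by rewrite big_ord_recr /=; exact: borelU.
have bT i : borel_set (T i).
  by apply: open_borel; apply: open_translate; exact: open_sumsetr.
have trivE : trivIset setT E.
  exact: trivIset_setIl (trivIset_seqDU _).
have D_E x : D x -> exists2 i, (i < size s)%N & E i x.
  move=> Dx; have [w ws Vx] := sG x I.
  have : (\bigcup_(i < size s) translate (v i) V) x.
    exists (index w s); first by rewrite /= index_mem.
    by rewrite /v nth_index.
  rewrite bigcup_mkord (bigsetU_seqDU (fun i => translate (v i) V)) -bigcup_mkord.
  move=> -[i /= ltis Ex].
  by exists i.
have c_mu (i : nat) : c * mu (E i) <= mu (E i) * mu (P `&` T i).
  have [->|/set0P[d [Dd Sd]]] := eqVneq (E i) set0.
    by rewrite (mu_set0 mu_reg) mulr0 mul0r lexx.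
  rewrite mulrC; apply: ler_wpM2l; first exact: (mu_ge0 mu_reg).
  apply: le_trans (cD d Dd) _; apply: (mu_le mu_reg).
  - by apply: borelI => //; apply: compact_borel => //; exact: compact_translate.
  - exact: borelI.
  - apply: setIS => _ [q Qq <-].
    have [u Vu <-] := subset_seqDU Sd; rewrite /T.
    exists (q + u); first by exists q => //; exists u.
    by rewrite (addrC q) addrA.
apply: (@le_trans _ _ (\sum_(i < size s) mu (E i) * mu (P `&` T i))).
  apply: (@le_trans _ _ (\sum_(i < size s) c * mu (E i))).
    rewrite -mulr_sumr; apply: ler_wpM2l => //.
    exact: (mu_le_sum mu_reg).
  by apply: ler_sum => i _; exact: c_mu.
apply: (@le_trans _ _ (mu U * mu P)); last first.
  have P0 := mu_ge0 mu_reg bP; have P1 := mu_le1 mu_reg bP.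
  apply: (@le_trans _ _ ((mu (-%R @` Q) + eps) * mu P)).
    by apply: ler_wpM2r => //; exact: ltW.
  by rewrite mulrDl [mu P * _]mulrC lerD2l ler_piMr // ltW.
apply: (weighted_sum_mu_le mu_reg (a := fun i => mu (E i)) bT bP) => x _.
(* For fixed [x], the pieces with [x] in [T i] are disjoint and all lie in [x + U], so their total
   measure is at most [mu U]. *)
pose E' i := if x \in T i then E i else set0.
have -> : \sum_(i < size s) mu (E i) * \1_(T i) x = \sum_(i < size s) mu (E' i).
  apply: eq_bigr => i _; rewrite indicE /E'; case: ifP => _; first by rewrite mulr1.
  by rewrite mulr0 (mu_set0 mu_reg).
rewrite -(mu_translate x); last exact: open_borel.
apply: (sum_mu_le mu_reg (E := E')).
- by move=> i; rewrite /E'; case: ifP => // _; exact: borel0.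
- apply/trivIsetP => i j _ _ ij; rewrite /E'.
  case: ifP => _; rewrite ?set0I //; case: ifP => _; rewrite ?setI0 //.
  by move/trivIsetP : trivE; exact.
- by apply: open_borel; exact: open_translate.
move=> i _; rewrite /E'; case: (boolP (x \in T i)) => [xT|_ y []].
have [_ [q Qq [u Vu <-]] <-] := set_mem xT.
move=> y [_ Sy]; have [u' Vu' <-] := subset_seqDU Sy.
(* If x = v + q + u and y = v + u', then y = x + (-q + (u' - u)). *)
exists (- q + (u' - u)); last first.
  by rewrite -addrA addrACA subrr add0r addrC [u + _]addrC subrK addrC.
apply: WU; exists (- q); first by exists q.
exists (u' - u) => //; apply: VW; exists u'; first by rewrite /= sumset0r.
by exists u => //; rewrite /= sumset0r.
Qed.

(** With [P] and [D] the whole group and [c = mu K], the double count gives [mu K <= mu (-K)];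
    applied to [-K] it gives the converse. *)
Lemma mu_opp Q : compact Q -> mu (-%R @` Q) = mu Q.
Proof.
have le_opp K : compact K -> mu K <= mu (-%R @` K).
  move=> cK; have bK := compact_borel hG cK.
  have := @mu_mul_le_opp (mu K) setT K setT (mu_ge0 mu_reg bK) borelT cK borelT.
  rewrite (mu_setT mu_reg) mulr1 mul1r; apply => d _.
  by rewrite setTI mu_translate.
move=> cQ; apply/eqP; rewrite eq_le le_opp // andbT.
have := le_opp _ (compact_opp cQ).
suff -> : -%R @` (-%R @` Q) = Q by [].
apply/seteqP; split=> [_ [_ [q Qq <-] <-]|q Qq]; first by rewrite opprK.
by exists (- q); [exists q|rewrite opprK].
Qed.

(* This replaces Fubini's theorem, which does not apply directly: when [G] is
   not metrizable, the set of pairs (x, d) with x - d in [Q] need not belong to the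
   product of the Borel sigma-algebras. *)
Lemma mu_mul_le (c : R) P Q D :
  borel_set P -> sigma_compact Q -> borel_set D ->
  (forall d, D d -> c <= mu (P `&` translate d Q)) ->
  c * mu D <= mu P * mu Q.
Proof.
move=> bP [F [cF ndF ->]] bD cD.
have bF n : borel_set (F n) := compact_borel hG (cF n).
have muF := mu_nondecreasing_cvg mu_reg bF ndF.
set Q' := \bigcup_n F n in cD muF *.
have bQ' : borel_set Q' by exact: borel_bigcup.
have bt (d : G) (E : set G) : sigma_compact E -> borel_set (translate d E).
  by move=> sE; apply: (sigma_compact_borel hG); exact: sigma_compact_translate.
have sQ' : sigma_compact Q' by exists F.
(* [Q'] is replaced by its compact part [F n], at the cost of lowering [c] by [mu Q' - mu (F n)],
   which vanishes in the limit. *)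
have cv : ((c - (mu Q' - mu (F n))) * mu D) @[n --> \oo]
    --> (c - (mu Q' - mu Q')) * mu D.
  apply: cvgM; last exact: cvg_cst.
  by apply: cvgB; [exact: cvg_cst|apply: cvgB => //; exact: cvg_cst].
rewrite subrr subr0 in cv.
apply: (ler_cvg_to cv (cvg_cst (mu P * mu Q'))); apply: nearW => n.
set c' := c - _.
have FQ : F n `<=` Q' by move=> x Fx; exists n.
have le_muF : mu (F n) <= mu Q' by exact: (mu_le mu_reg).
apply: (@le_trans _ _ (mu P * mu (F n))); last first.
  by apply: ler_wpM2l => //; exact: (mu_ge0 mu_reg).
(* The compact case needs a nonnegative constant; for negative [c'] the left side is already
   nonpositive. *)
have [c'0|c'0] := lerP 0 c'; last first.
  apply: (@le_trans _ _ 0).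
    by rewrite nmulr_rle0 //; exact: (mu_ge0 mu_reg).
  by apply: mulr_ge0; exact: (mu_ge0 mu_reg).
rewrite -(mu_opp (cF n)); apply: mu_mul_le_opp => // d Dd.
rewrite lerBlDr; apply: le_trans (cD d Dd) _.
have bd : borel_set (translate d (F n)).
  by apply: bt; exact: compact_sigma_compact.
have bd' := bt d _ sQ'.
have -> : mu Q' - mu (F n) = mu (translate d Q' `\` translate d (F n)).
  rewrite -(mu_translate d bQ') -(mu_translate d (bF n)).
  rewrite [X in X - _](muD mu_reg bd' bd) (setIidr (translateS FQ)).
  by rewrite addrAC subrr add0r.
apply: le_trans (mu_leU mu_reg _ _); [|exact: borelI|exact: borelD].
apply: (mu_le mu_reg); first exact: borelI.
  by apply: borelU; [exact: borelI|exact: borelD].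
move=> x [Px dx]; have [Fx|nFx] := pselect (translate d (F n) x); [by left|by right].
Qed.

Lemma nsumset_finite n (C : set G) x : nsumset n C x ->
  exists2 s : seq G, [set` s] `<=` C & nsumset n [set` s] x.
Proof.
elim: n x => [|n IHn] x /=; first by exists [::].
move=> [a Ca [b /IHn[s sC bs] <-]]; exists (a :: s).
  by move=> y /=; rewrite in_cons => /orP[/eqP ->|/sC].
exists a; first by rewrite /= mem_head.
exists b => //; apply: nsumsetS bs => y /= ys.
by rewrite in_cons ys orbT.
Qed.

(* Petridis' inequality only controls finite subsets [F] of [C].  For an [F] which
   nearly maximizes both mu (X + mF) and mu (X + nF), enlarging [F] hardly changes
   mu ((X + mF) `&` (d + X + nF)); this number is therefore almost at least mu X
   for every [d] in mC - nC, and not only in mF - nF. *)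
Lemma compact_plunnecke_ruzsa (C K : set G) (lam : R) m n :
  compact C -> compact K -> 0 <= lam -> mu (sumset K C) < lam * mu K ->
  mu (diffsumset m n C) <= lam ^+ (m + n) * mu K.
Proof.
move=> cC cK lam0 ltK.
have bK := compact_borel hG cK.
have [X [sX XK minX]] := plunnecke_defect_minimizer hG mu_haar cC lam0 cK.
have phiX0 : plunnecke_defect (mu := mu) C lam X < 0.
  apply: le_lt_trans (minX K (compact_sigma_compact cK) _) _ => //.
  by rewrite /plunnecke_defect subr_lt0.
have bX := sigma_compact_borel hG sX.
(* If [mu X] were 0, the defect would be [mu (X + C)], which is not negative. *)
have muX0 : 0 < mu X.
  rewrite lt_neqAle (mu_ge0 mu_reg bX) andbT; apply/eqP => muX.
  move: phiX0; rewrite /plunnecke_defect -muX mulr0 subr0 ltNge.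
  rewrite (mu_ge0 mu_reg) //; apply: (sigma_compact_borel hG).
  by apply: sigma_compact_sumset => //; exact: compact_sigma_compact.
pose H j (s : seq G) := sumset X (nsumset j [set` s]).
have sH j s : sigma_compact (H j s).
  have [t tE] := nsumset_seq j s; rewrite /H tE; apply: sigma_compact_sumset => //.
  by apply: compact_sigma_compact; apply: finite_compact; exact: finite_seq.
have bH j s : borel_set (H j s) := sigma_compact_borel hG (sH j s).
have H_S j (s t : seq G) : {subset s <= t} -> H j s `<=` H j t.
  by move=> st; apply: sumsetS => //; apply: nsumsetS => x /st.
have H_le j (s : seq G) : [set` s] `<=` C -> mu (H j s) <= lam ^+ j * mu X.
  move=> sC.
  exact: (plunnecke_finite hG mu_haar cC lam0 j sX XK minX (ltW phiX0) sC).
(* A maximizer need not exist, but the values are bounded by 1, so some [s] comes within [eps] of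
   the supremum. *)
have H_max j eps : 0 < eps -> exists2 s : seq G, [set` s] `<=` C &
    forall t : seq G, [set` t] `<=` C -> mu (H j t) < mu (H j s) + eps.
  move=> eps0; pose M := [set mu (H j s) | s in [set s : seq G | [set` s] `<=` C]].
  have M0 : M !=set0 by exists (mu (H j [::])), [::] => // x.
  have [||_ [s sC <-] Ms] := @sup_gt _ M (sup M - eps) => //.
    by rewrite ltrBlDr ltrDl.
  exists s => // t tC; rewrite -ltrBlDr; apply: le_lt_trans Ms.
  rewrite lerD2r; apply: ub_le_sup; last by exists t.
  by exists 1 => _ [u _ <-]; exact: (mu_le1 mu_reg).
have bD : borel_set (diffsumset m n C).
  by apply: compact_borel => //; exact: compact_diffsumset.
have D1 := mu_le1 mu_reg bD.
have main : mu X * mu (diffsumset m n C) <= lam ^+ (m + n) * mu X * mu X.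
  apply/ler_addgt0Pr => e e0.
  have e2 : 0 < e / 2 by rewrite divr_gt0.
  have [s1 s1C max1] := H_max m _ e2; have [s2 s2C max2] := H_max n _ e2.
  pose s := s1 ++ s2.
  have sC : [set` s] `<=` C.
    by move=> x /=; rewrite mem_cat => /orP[/s1C|/s2C].
  have s1s : {subset s1 <= s} by move=> x xs; rewrite mem_cat xs.
  have s2s : {subset s2 <= s} by move=> x xs; rewrite mem_cat xs orbT.
  clearbody s.
  have PQ d : diffsumset m n C d -> mu X - e <= mu (H m s `&` translate d (H n s)).
    move=> [a /nsumset_finite[u uC ua] [b /nsumset_finite[v vC vb] abd]].
    pose t := s ++ (u ++ v).
    have tC : [set` t] `<=` C.
      by move=> x /=; rewrite !mem_cat => /or3P[/sC|/uC|/vC].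
    have st : {subset s <= t} by move=> x xs; rewrite mem_cat xs.
    have at_ : nsumset m [set` t] a.
      by apply: nsumsetS ua => x /= xu; rewrite !mem_cat xu orbT.
    have bt : nsumset n [set` t] b.
      by apply: nsumsetS vb => x /= xv; rewrite !mem_cat xv !orbT.
    have btr j r : borel_set (translate d (H j r)).
      by apply: (sigma_compact_borel hG); exact: sigma_compact_translate.
    have diff1 : mu (H m t `\` H m s) <= e / 2.
      have := max1 t tC; have := mu_le mu_reg (bH m s1) (bH m s) (H_S m _ _ s1s).
      rewrite (muD mu_reg (bH m t) (bH m s)) (setIidr (H_S m _ _ st)); lra.
    have diff2 : mu (translate d (H n t) `\` translate d (H n s)) <= e / 2.
      have := max2 t tC; have := mu_le mu_reg (bH n s2) (bH n s) (H_S n _ _ s2s).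
      rewrite -(mu_translate d (bH n t)) (muD mu_reg (btr n t) (btr n s)).
      rewrite (setIidr (translateS (H_S n _ _ st))) (mu_translate d (bH n s)); lra.
    set P := H m s; set Q := translate d (H n s).
    set P' := H m t; set Q' := translate d (H n t).
    have bPQ : borel_set (P `&` Q) := borelI (bH m s) (btr n s).
    have bP' : borel_set (P' `\` P) := borelD (bH m t) (bH m s).
    have bQ' : borel_set (Q' `\` Q) := borelD (btr n t) (btr n s).
    (* If [d = a - b], then [a + x = d + (x + b)], so [a + X] lies in both [P'] and [Q']; its parts
       outside [P] or [Q] have total measure at most [e]. *)
    have XPQ : mu X <= mu ((P `&` Q) `|` ((P' `\` P) `|` (Q' `\` Q))).
      rewrite -(mu_translate a bX); apply: (mu_le mu_reg).
      - by apply: (sigma_compact_borel hG); exact: sigma_compact_translate.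
      - by apply: borelU => //; exact: borelU.
      - move=> _ [x Xx <-].
        have xP' : P' (a + x) by exists x => //; exists a => //; rewrite addrC.
        have xQ' : Q' (a + x).
          exists (x + b); first by exists x => //; exists b.
          by rewrite -abd addrACA addNr addr0.
        have [xP|nxP] := pselect (P (a + x)); last by right; left.
        by have [xQ|nxQ] := pselect (Q (a + x)); [left|right; right].
    have := mu_leU mu_reg bPQ (borelU bP' bQ').
    have := mu_leU mu_reg bP' bQ'.
    rewrite -/P -/P' in diff1; rewrite -/Q -/Q' in diff2; lra.
  have := mu_mul_le (bH m s) (sH n s) bD PQ.
  have := H_le m s sC; have := H_le n s sC.
  have Hm0 := mu_ge0 mu_reg (bH m s); have Hn0 := mu_ge0 mu_reg (bH n s).
  move=> hn hm hD; have := ler_pM Hm0 Hn0 hm hn.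
  rewrite mulrACA -exprD mulrA.
  have : e * mu (diffsumset m n C) <= e by rewrite ler_piMr // ltW.
  by move: hD; rewrite mulrBl; lra.
(* One positive factor [mu X] cancels in [main]; the other is at most [mu K]. *)
apply: (@le_trans _ _ (lam ^+ (m + n) * mu X)).
  by rewrite -(ler_pM2l muX0) [X in _ <= X]mulrC.
by apply: ler_wpM2l; [exact: exprn_ge0|exact: (mu_le mu_reg)].
Qed.

(* Choquet's capacitability argument, carried out for the set function
   L |-> mu^* (mL - nL) directly on a K_sigma_delta set parametrizing [B]. *)
Lemma K_analytic_capacitable (B : set G) m n t : K_analytic B ->
  t < outer_meas mu (diffsumset m n B) ->
  exists L, [/\ compact L, L `<=` B & t <= mu (diffsumset m n L)].
Proof.
move=> [Y [S [f [hY [K [cK SE]] cf ->]]]] tB.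
pose D T := outer_meas mu (diffsumset m n (f @` T)).
(* Finite unions make the inner unions increasing, so that continuity of the outer measure from
   below applies. *)
pose K' i j := \big[setU/set0]_(k < j.+1) K i k.
have K'E i j : K' i j = \bigcup_(k < j.+1) K i k by rewrite bigcup_mkord.
have cK' i j : compact (K' i j).
  by apply: bigsetU_compact => k _; exact: cK.
have ndK' i j : K' i j `<=` K' i j.+1.
  by rewrite /K' [X in _ `<=` X]big_ord_recr; exact: subsetUl.
have step (p : nat * set Y) : exists j,
    p.2 `<=` S -> t < D p.2 -> t < D (p.2 `&` K' p.1 j).
  case: p => i T /=; have [[TS tT]|] := pselect (T `<=` S /\ t < D T); last first.
    by move=> nT; exists 0%N => TS tT; exfalso; apply: nT.
  have TE : f @` T = \bigcup_j f @` (T `&` K' i j).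
    apply/seteqP; split=> [_ [x Tx <-]|y [j _ [x [Tx _] <-]]]; last by exists x.
    have := TS x Tx; rewrite SE => /(_ i I)[j _ Kx].
    by exists j => //; exists x => //; split => //; rewrite K'E; exists j => /=.
  have ndT j : f @` (T `&` K' i j) `<=` f @` (T `&` K' i j.+1).
    by apply: image_subset; apply: setIS.
  move: tT; rewrite /D TE diffsumset_nondecreasing_bigcup // => tT.
  have [|j tj] := lt_outer_meas_bigcup mu_reg _ tT; last by exists j.
  by move=> j; exact: diffsumsetS.
have [jj hjj] := choice step.
(* Starting from [S], each step cuts with a compact [K' i j] chosen to keep the outer measure above
   [t]. *)
pose T := fix T i := if i is i'.+1 then T i' `&` K' i' (jj (i', T i')) else S.
pose k i := K' i (jj (i, T i)).
have TS i : T i `<=` S by elim: i => [|i IHi] //= x [/IHi].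
have tT i : t < D (T i).
  by elim: i => [|i IHi] //=; exact: (hjj (i, T i) (TS i) IHi).
have Tk N i : (i < N)%N -> T N `<=` k i.
  elim: N => // N IHN; rewrite ltnS leq_eqVlt => /orP[/eqP -> x []//|iN].
  by move=> x [/(IHN iN)].
pose L := \bigcap_i k i.
have ck i : compact (k i) by exact: cK'.
have clk i : closed (k i) by exact: compact_closed.
have cL : compact L.
  apply: (subclosed_compact _ (ck 0%N)); last by move=> x; apply.
  by apply: closed_bigI => i _; exact: clk.
have LS : L `<=` S.
  move=> x Lx; rewrite SE => i _; have := Lx i I.
  by rewrite /k K'E => -[j _ Kx]; exists j.
exists (f @` L); split.
- apply: continuous_compact => //; exact: continuous_subspaceW LS cf.
- exact: image_subset.
rewrite leNgt; apply/negP => Lt.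
have cfL : compact (f @` L).
  by apply: continuous_compact => //; exact: continuous_subspaceW LS cf.
have bDL : borel_set (diffsumset m n (f @` L)).
  by apply: compact_borel => //; exact: compact_diffsumset.
have [U [oU DU Ut]] := mu_lt_open mu_reg bDL Lt.
have [V [oV LV VU]] := compact_open_diffsumset cfL oU DU.
have [W oW WV] : exists2 W, open W & W `&` S = f @^-1` V `&` S.
  by apply/open_subspaceP; move/continuousP : cf; exact.
(* These increasing open sets cover [k 0]: a point that lies in every [k i] is in [L], hence in
   [W]. *)
pose V' N := W `|` \bigcup_(i in [set i | (i < N)%N]) ~` k i.
have [N k0N] : exists N, k 0%N `<=` V' N.
  apply: compact_nondecreasing_cover => //.
  - move=> N; apply: openU => //; apply: bigcup_open => i _.
    exact: closed_openC.
  - move=> N; apply: setUS => x [i /= iN kx]; exists i => //=.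
    exact: ltnW.
  - move=> x _; have [Lx|/existsNP[i nkx]] := pselect (forall i, k i x).
      exists 0%N => //; left.
      have Lx' : L x by move=> i _; exact: Lx.
      have : (f @^-1` V `&` S) x by split; [apply: LV; exists x|exact: LS].
      by rewrite -WV => -[].
    by exists i.+1 => //; right; exists i => /=.
(* The index [N.+1] puts [T N.+1] inside [k 0] even when [N] is 0. It also lies in every [k i] with
   [i < N], so the cover leaves only [W]. *)
have TV : f @` T N.+1 `<=` V.
  move=> _ [x Tx <-]; have [Wx|[i /= iN nkx]] := k0N x (Tk N.+1 0%N isT x Tx).
    have : (W `&` S) x by split => //; exact: TS Tx.
    by rewrite WV => -[].
  by exfalso; apply: nkx; apply: Tk Tx; exact: ltnW.
have := tT N.+1; rewrite ltNge => /negP; apply; apply: ltW; apply: le_lt_trans Ut.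
apply: (outer_meas_le mu_reg); first exact: open_borel.
by apply: subset_trans VU; exact: diffsumsetS.
Qed.

End CompactGroup.

(** * Reduction to compact sets and the limit in [lam] *)

Unset Implicit Arguments.
Set Strict Implicit.

Theorem theorem5p1 (R : realType) (G : topologicalZmodType) (mu : set G -> R)
  (A B : set G) (alpha : R) :
  hausdorff_space G -> compact [set: G] -> haar_probability mu ->
  K_analytic B ->
  0 < inner_meas mu (sumset A B) ->
  inner_meas mu (sumset A B) <= alpha * inner_meas mu A ->
  forall m n : nat,
    outer_meas mu (diffsumset m n B) <= alpha ^+ (m + n) * inner_meas mu A.
Proof.
move=> hG cG mu_haar aB AB0 ABle m n; set a := inner_meas mu A in ABle *.
have mu_reg := mu_haar.1.
have aa0 : 0 < alpha * a := lt_le_trans AB0 ABle.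
have a_ge0 : 0 <= a by exact: (inner_meas_ge0 mu_reg hG).
have a0 : 0 < a.
  by rewrite lt_neqAle a_ge0 andbT; apply: contraTneq aa0 => <-; rewrite mulr0 ltxx.
have alpha0 : 0 < alpha by rewrite -(pmulr_lgt0 _ a0).
have le_lam lam : alpha < lam ->
    outer_meas mu (diffsumset m n B) <= lam ^+ (m + n) * a.
  move=> alam; have lam0 : 0 < lam := lt_trans alpha0 alam.
  rewrite leNgt; apply/negP => lt_out.
  (* Capacitability yields only a weak inequality; the midpoint keeps the contradiction strict. *)
  have [|L [cL LB]] := @K_analytic_capacitable _ _ _ hG mu_haar B m n
    ((lam ^+ (m + n) * a + outer_meas mu (diffsumset m n B)) / 2) aB.
    by rewrite midf_lt.
  apply/negP; rewrite -ltNge.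
  (* As [alpha < lam], the number [alpha * a / lam] is below [a]. This choice gives
     [mu (K + L) <= alpha * a < lam * mu K]. *)
  have [K [cK KA Ka]] : exists K, [/\ compact K, K `<=` A & alpha * a / lam < mu K].
    apply: inner_meas_gt; rewrite ltr_pdivrMr // mulrC.
    by rewrite ltr_pM2l.
  have cKL := compact_sumset cK cL.
  apply: le_lt_trans (_ : lam ^+ (m + n) * a < _); last by rewrite midf_lt.
  apply: le_trans (compact_plunnecke_ruzsa hG cG mu_haar m n cL cK (ltW lam0) _) _.
    apply: (@le_lt_trans _ _ (alpha * a)).
      apply: le_trans ABle; apply: (inner_meas_ge mu_reg hG) => //.
      exact: sumsetS.
    by rewrite [X in _ < X]mulrC -ltr_pdivrMr.
  apply: ler_wpM2l; first by rewrite exprn_ge0 // ltW.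
  exact: (inner_meas_ge mu_reg hG).
(* Now [lam] tends to [alpha] along [alpha + 1 / (k + 1)]. *)
have cv : ((alpha + k.+1%:R^-1) ^+ (m + n) * a) @[k --> \oo]
    --> (alpha + 0) ^+ (m + n) * a.
  apply: cvgM; last exact: cvg_cst.
  have cva : (alpha + k.+1%:R^-1) @[k --> \oo] --> alpha + 0.
    by apply: cvgD; [exact: cvg_cst|exact: cvg_harmonic].
  elim: (m + n)%N => [|N IHN]; first exact: cvg_cst.
  by rewrite exprS; under eq_fun do rewrite exprS; exact: cvgM.
rewrite addr0 in cv.
apply: (ler_cvg_to (cvg_cst _) cv); apply: nearW => k; apply: le_lam.
by rewrite ltrDl invr_gt0.
Qed.
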